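(* For any $k\ge2$ groups in which all agents have binary utilities, there exists an allocation $(G_1,\dots,G_k)$ such that for every $i$, at least $n_i/k$ agents of $A_i$ find it simultaneously EF1, PROP$(k-1)$ and MMS-fair.
   Context: There is a finite set $G$ of goods and $k$ groups $A_1,\dots,A_k$ with $n_i\ge1$ agents in $A_i$. A binary agent has an additive utility with $u_a(\{g\})\in\{0,1\}$. An allocation is a partition $(G_1,\dots,G_k)$ of $G$; agents of $A_i$ get $u_a(G_i)$. For $a\in A_i$: EF1 means for every $i'$ there is $C\subseteq G_{i'}$, $|C|\le1$, with $u_a(G_i)\ge u_a(G_{i'}\setminus C)$; PROP$(k-1)$ means there is $C\subseteq G\setminus G_i$, $|C|\le k-1$, with $u_a(G_i)\ge\frac1k u_a(G\setminus C)$; MMS-fair means $u_a(G_i)\ge \mathrm{MMS}^k_a(G)$, where $\mathrm{MMS}^k_a(G)$ is the maximum over partitions of $G$ into $k$ sets of the minimum of $u_a$ over those sets. *)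

(* Defs.v *)
From mathcomp Require Import all_boot.
Set Implicit Arguments. Unset Strict Implicit. Unset Printing Implicit Defensive.

Section Fair.
Variable G : finType.

Definition util (v : G -> bool) (S : {set G}) : nat := \sum_(g in S) (v g : nat).

Definition bundle (k : nat) (alloc : {ffun G -> 'I_k}) (j : 'I_k) : {set G} :=
  [set g | alloc g == j].

Definition EF1 (k : nat) (v : G -> bool) (alloc : {ffun G -> 'I_k}) (i : 'I_k) : bool :=
  [forall i' : 'I_k, [exists C : {set G},
     [&& C \subset bundle alloc i', #|C| <= 1 &
         util v (bundle alloc i' :\: C) <= util v (bundle alloc i)]]].

(* PROP(k-1): u(G_i) >= (1/k) u(G \ C), written as k * u(G_i) >= u(G \ C) *)
Definition PROPk1 (k : nat) (v : G -> bool) (alloc : {ffun G -> 'I_k}) (i : 'I_k) : bool :=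
  [exists C : {set G},
     [&& C \subset ~: bundle alloc i, #|C| <= k.-1 &
         util v (~: C) <= k * util v (bundle alloc i)]].

(* maximin share: max over partitions of G into k (possibly empty) sets of the
   minimum utility of a part; the min is taken with neutral element u(G),
   which is an upper bound of every part's utility *)
Definition MMS (k : nat) (v : G -> bool) : nat :=
  \max_(P : {ffun G -> 'I_k}) \big[minn/util v setT]_(j < k) util v (bundle P j).

Definition MMS_fair (k : nat) (v : G -> bool) (alloc : {ffun G -> 'I_k}) (i : 'I_k) : bool :=
  MMS k v <= util v (bundle alloc i).

End Fair.

(* Main.v *)
Require Import Defs.
From mathcomp Require Import all_boot.
From mathcomp Require Import fingroup perm zify.
Set Implicit Arguments. Unset Strict Implicit. Unset Printing Implicit Defensive.

(** Put the goods on a line, each blown up into k unit copies, and cut the line at k - 1 integer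
    positions. In a Kuhn cell of the space of cuts the k vertices can be owned by the k groups,
    one each. Label a vertex by a nonempty piece that at least a 1/k fraction of its owner's
    agents like best; such a piece exists by pigeonhole. A Sperner argument gives a cell whose
    labels are all distinct, which matches the groups with the pieces. Each of the k - 1 cuts
    varies over one unit interval inside the cell, so some threshold mod k is crossed by none of
    them, and rounding every cut to whole goods at that threshold gives the same allocation from
    every vertex. Each piece changes by strictly less than one good, so, the utilities being
    integers, an envy-free agent ends up with at most one good of envy. For binary utilities
    this bound implies EF1, PROP(k-1) and MMS-fairness. *)

(** * Parity by fixed-point-free involutions *)

Lemma even_card_involution (T : finType) (A : {set T}) (f : T -> T) :
  {in A, forall x, f x \in A} -> {in A, forall x, f (f x) = x} ->
  {in A, forall x, f x != x} -> ~~ odd #|A|.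
Proof.
move: {2}#|A| (leqnn #|A|) => n; elim: n A => [|n IHn] A leA fA fK fN.
  by move: leA; rewrite leqn0 => /eqP ->.
case: (set_0Vmem A) => [->|[x Ax]]; first by rewrite cards0.
have fx2 : f x \in A :\ x by rewrite !inE fN // fA.
rewrite (cardsD1 x) Ax (cardsD1 (f x)) fx2 /= negbK.
have sz : #|A :\ x :\ f x| <= n.
  by move: leA; rewrite (cardsD1 x) Ax (cardsD1 (f x)) fx2; lia.
apply: (IHn _ sz) => y; rewrite !inE => /and3P[yfx yx Ay].
- rewrite fA // andbT; apply/andP; split; apply/eqP=> e.
    by move: yx; rewrite -(fK y Ay) e fK // eqxx.
  by move: yfx; rewrite -(fK y Ay) e eqxx.
- exact: fK.
- exact: fN.
Qed.

(** * A Sperner lemma on the Kuhn triangulation of a box *)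

Section Sperner.
Variables (m M : nat).

(* The m+1 cuts c bound pieces 0 .. m+1 of the segment [0, M]; piece l goes from [cut c l]
   to [cut c l.+1]. Coordinates need not be sorted, so pieces may have negative length. *)
Definition cut (c : {ffun 'I_m.+1 -> nat}) (l : nat) : nat :=
  if l == 0 then 0 else if l <= m.+1 then c (inord l.-1) else M.

(* A simplex of the Kuhn triangulation of the box [0, M+1]^(m+1), given by its least vertex v
   and a permutation p: from v, step p j (counted from 0) increments coordinate j. *)
Definition cell := ({ffun 'I_m.+1 -> 'I_M.+1} * {perm 'I_m.+1})%type.

Definition vertex (x : cell) (t : nat) : {ffun 'I_m.+1 -> nat} :=
  [ffun j => x.1 j + (x.2 j < t)].

Lemma vertexE x t j : vertex x t j = x.1 j + (x.2 j < t).
Proof. by rewrite ffunE. Qed.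

Lemma cut0 c : cut c 0 = 0. Proof. by []. Qed.
Lemma cutS c (j : 'I_m.+1) : cut c j.+1 = c j.
Proof. by rewrite /cut /= ltn_ord inord_val. Qed.
Lemma cut_last c : cut c m.+2 = M.
Proof. by rewrite /cut /= ltnn. Qed.

(** Along a cell every cut, fixed ends included, moves at most once, by one unit to the right. *)
Lemma cut_vertex x (l : nat) : exists b, exists p : nat -> bool,
  (forall s t, s <= t -> p s <= p t) /\ forall t, cut (vertex x t) l = b + p t.
Proof.
case: l => [|l]; first by exists 0, (fun=> false); split=> // t; rewrite cut0.
case: (ltnP l m.+1) => hl; last first.
  exists M, (fun=> false); split=> // t; rewrite /cut /=.
  by rewrite ltnNge hl /= addn0.
exists (x.1 (inord l)), (fun t => x.2 (inord l) < t); split=> [s t st|t].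
  by lia.
by rewrite /cut /= hl vertexE.
Qed.

(** From one vertex to another, both ends of a piece shift the same way by at most one unit, so its
    length drops by at most one. *)
Lemma cut_vertex_le x s t l :
  cut (vertex x s) l < cut (vertex x s) l.+1 ->
  cut (vertex x t) l <= cut (vertex x t) l.+1.
Proof.
have [b [p [hp hb]]] := cut_vertex x l.
have [b' [p' [hp' hb']]] := cut_vertex x l.+1.
rewrite !hb !hb'; case: (leqP s t) => [/[dup] /hp + /hp'|/ltnW /[dup] /hp + /hp'].
all: by case: (p s) (p t) (p' s) (p' t) => [] [] [] []; lia.
Qed.

Lemma vertex_ub x t j : vertex x t j <= M.+1.
Proof. by rewrite vertexE; have := ltn_ord (x.1 j); lia. Qed.

(** * Doors and their pairing inside a cell *)

Variable lab : {ffun 'I_m.+1 -> nat} -> 'I_m.+2.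
(** These two hypotheses replace Sperner's boundary condition: a label names a piece of positive
    length, and the last such piece once the last cut is at [M.+1]. *)
Hypothesis lab_lt : forall c : {ffun 'I_m.+1 -> nat}, cut c (lab c) < cut c (lab c).+1.
Hypothesis lab_out : forall c : {ffun 'I_m.+1 -> nat}, c ord_max = M.+1 ->
  forall l : nat, lab c < l -> l <= m.+1 -> cut c l.+1 <= cut c l.

(* y = (x, t) stands for the facet of x opposite to its t-th vertex. *)
Definition door (y : cell * 'I_m.+2) :=
  [forall l : 'I_m.+2, (l < m.+1) ==>
    [exists s : 'I_m.+2, (s != y.2) && (lab (vertex y.1 s) == l)]].

Lemma doorP y : reflect (forall l : 'I_m.+2, l < m.+1 ->
    exists2 s : 'I_m.+2, s != y.2 & lab (vertex y.1 s) = l) (door y).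
Proof.
apply: (iffP forallP) => H l.
  by move=> hl; move: (H l); rewrite hl => /existsP[s /andP[st /eqP sl]]; exists s.
by apply/implyP => /H[s st sl]; apply/existsP; exists s; rewrite st sl eqxx.
Qed.

(** Each label up to [m] occurs on the facet, so the piece it names is nonempty at some vertex and
    has nonnegative length at all of them. *)
Lemma door_mono y s j j' : door y -> j <= j' -> j' <= m.+1 ->
  cut (vertex y.1 s) j <= cut (vertex y.1 s) j'.
Proof.
move=> /doorP dy; elim: j' => [|j' IH]; first by rewrite leqn0 => /eqP ->.
rewrite leq_eqVlt => /orP[/eqP -> //|]; rewrite ltnS => jj' hj'.
apply: leq_trans (IH jj' (ltnW hj')) _.
have hj2 : j' < m.+2 by lia.
have [t _ lt] := dy (Ordinal hj2) hj'.
apply: (@cut_vertex_le _ t); move: (lab_lt (vertex y.1 t)).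
by rewrite lt.
Qed.

Lemma door_inj y : door y ->
  {in [set~ y.2] &, injective (fun s : 'I_m.+2 => lab (vertex y.1 s))}.
Proof.
move=> /doorP dy; apply/imset_injP; rewrite eqn_leq leq_imset_card /=.
have -> : #|[set~ y.2]| = #|[set~ (@ord_max m.+1)]| by rewrite !cardsC1.
apply/subset_leq_card/subsetP => l; rewrite !inE => ln.
have hl : l < m.+1 by move: ln; rewrite -val_eqE /=; have := ltn_ord l; lia.
by have [s st <-] := dy l hl; apply: imset_f; rewrite !inE.
Qed.

Definition full (x : cell) := [forall l, exists s : 'I_m.+2, lab (vertex x s) == l].

(** In a cell that is not full, the vertex opposite a door repeats the label of exactly one other
    vertex; exchanging the two gives the cell's only other door. *)
Definition rotate (y : cell * 'I_m.+2) : cell * 'I_m.+2 :=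
  if [pick s | (s != y.2) && (lab (vertex y.1 s) == lab (vertex y.1 y.2))] is Some s
  then (y.1, s) else y.

Lemma rotateP y : door y -> ~~ full y.1 -> exists2 s : 'I_m.+2,
  s != y.2 /\ lab (vertex y.1 s) = lab (vertex y.1 y.2) & rotate y = (y.1, s).
Proof.
move=> /doorP dy nf; rewrite /rotate; case: pickP => [s /andP[st /eqP e]|no].
  by exists s.
case/negP: nf; apply/forallP => l; apply/existsP.
case: (ltnP l m.+1) => hl; first by have [s _ <-] := dy l hl; exists s.
exists y.2; case: (ltnP (lab (vertex y.1 y.2)) m.+1) => h.
  by have [s st e] := dy _ h; move: (no s); rewrite st e eqxx.
by rewrite -val_eqE /=; have := ltn_ord l; have := ltn_ord (lab (vertex y.1 y.2)); lia.
Qed.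

Lemma rotate_door y : door y -> ~~ full y.1 -> door (rotate y).
Proof.
move=> dy nf; have [s [st e] ->] := rotateP dy nf.
move/doorP: dy => dy; apply/doorP => l hl /=; have [r rt er] := dy l hl.
case: (eqVneq r s) => [rs|rs]; last by exists r.
by exists y.2; rewrite 1?eq_sym // -e -rs.
Qed.

Lemma rotateK y : door y -> ~~ full y.1 -> rotate (rotate y) = y.
Proof.
move=> dy nf; have := rotateP (rotate_door dy nf).
have [s [st e] ->] /= := rotateP dy nf => /(_ nf) [r [rs er] ->].
case: (eqVneq r y.2) => [->|ry]; first by case: (y).
by case/eqP: rs; apply: (door_inj dy); rewrite ?inE.
Qed.

Lemma even_doors : (forall x, ~~ full x) -> ~~ odd #|[set y | door y]|.
Proof.
move=> nf; apply: (@even_card_involution _ _ rotate) => y; rewrite inE => dy.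
- by rewrite inE rotate_door.
- exact: rotateK.
- by have [s [st _] ->] := rotateP dy (nf _); apply: contra st => /eqP <-.
Qed.

(** * Pairing doors across neighbouring cells *)

Definition pred_perm : {perm 'I_m.+1} := perm (can_inj (@ord_predK m.+1)).

(* The same facet seen from the neighbouring cell; a junk value when the facet lies in the
   boundary of the box. *)
Definition pivot (y : cell * 'I_m.+2) : cell * 'I_m.+2 :=
  let: ((v, p), t) := y in
  if t == ord0 then
    (([ffun j => inord (v j + (p j == ord0))], (p * pred_perm)%g), ord_max)
  else if t == ord_max then
    (([ffun j => inord (v j - (p j == ord_max))], (p * pred_perm^-1)%g), ord0)
  else ((v, (p * tperm (inord t.-1) (inord t))%g), t).

(** A neighbour is missing only when the first or last vertex is to be replaced and the base
    coordinate to be moved is already at [M] or 0. *)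
Definition boundary (y : cell * 'I_m.+2) :=
  [exists j, (y.2 == ord0) && (y.1.2 j == ord0) && (y.1.1 j == ord_max)
          || (y.2 == ord_max) && (y.1.2 j == ord_max) && (y.1.1 j == ord0)].

Lemma pred_permE (i : 'I_m.+1) : pred_perm i = if i == ord0 then ord_max else inord i.-1.
Proof.
rewrite permE; apply: val_inj => /=; case: i => [[|i] hi] /=.
  by rewrite modn_small; lia.
rewrite inordK; last by lia.
by rewrite modnDr modn_small; lia.
Qed.

Lemma pred_permVE (i : 'I_m.+1) :
  (pred_perm^-1)%g i = if i == ord_max then ord0 else inord i.+1.
Proof.
apply: (@perm_inj _ pred_perm); rewrite permKV pred_permE.
case: (eqVneq i ord_max) => [-> //|]; rewrite -!val_eqE /= => hi.
have hi2 : i.+1 < m.+1 by have := ltn_ord i; lia.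
rewrite inordK //=; apply: val_inj; rewrite /= inordK //; lia.
Qed.

Lemma boundaryPn y j : ~~ boundary y ->
  (y.2 == ord0 -> y.1.2 j == ord0 -> y.1.1 j < M) /\
  (y.2 == ord_max -> y.1.2 j == ord_max -> 0 < y.1.1 j).
Proof.
move=> /existsPn /(_ j); rewrite negb_or => /andP[h1 h2]; split=> e e'.
  move: h1; rewrite e e' /= -val_eqE /=; have := ltn_ord (y.1.1 j); lia.
by move: h2; rewrite e e' /= -val_eqE /=; lia.
Qed.

Lemma pivotK y : ~~ boundary y -> pivot (pivot y) = y.
Proof.
case: y => -[v p] t nb; rewrite /pivot.
have [t0|t0] := eqVneq t ord0.
  rewrite /= eqxx; congr (_, _, _); last by [].
    apply/ffunP => j; rewrite !ffunE permM pred_permE; apply: val_inj => /=.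
    have [h _] := boundaryPn j nb; move: h => /= h.
    have [pj|pj] := eqVneq (p j) ord0.
      have := h (introT eqP t0) (introT eqP pj).
      by move=> vj; rewrite eqxx /= !inordK; lia.
    rewrite -val_eqE /= in pj; rewrite -val_eqE /= !inordK; have := ltn_ord (p j);
      have := ltn_ord (v j); lia.
  by rewrite mulgK.
have [tm|tm] := eqVneq t ord_max.
  rewrite /=; congr (_, _, _); last by [].
    apply/ffunP => j; rewrite !ffunE permM pred_permVE; apply: val_inj => /=.
    have [_ h] := boundaryPn j nb; move: h => /= h.
    have [pj|pj] := eqVneq (p j) ord_max.
      have := h (introT eqP tm) (introT eqP pj).
      by have := ltn_ord (v j); move=> ? vj; rewrite eqxx /= !inordK; lia.
    rewrite -val_eqE /= in pj; rewrite -val_eqE /= !inordK; have := ltn_ord (p j);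
      have := ltn_ord (v j); lia.
  by rewrite mulgKV.
by rewrite (negPf t0) (negPf tm) -mulgA tperm2 mulg1.
Qed.

Lemma pivot_neq y : pivot y != y.
Proof.
case: y => -[v p] t; rewrite /pivot.
have [t0|t0] := eqVneq t ord0.
  by rewrite t0 xpair_eqE andbC -val_eqE.
have [tm|tm] := eqVneq t ord_max.
  by rewrite tm xpair_eqE andbC -val_eqE.
apply/eqP => -[/(congr1 (fun q => (p^-1 * q)%g))]; rewrite mulKg mulVg.
move=> /permP /(_ (inord t)); rewrite tpermR perm1 => /(congr1 val) /=.
move: t0 tm; rewrite -!val_eqE /= => t0 tm.
by rewrite !inordK; have := ltn_ord t; lia.
Qed.

Lemma pivot_vertex y (s : 'I_m.+2) : ~~ boundary y -> s != y.2 ->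
  exists2 s' : 'I_m.+2, s' != (pivot y).2 & vertex (pivot y).1 s' = vertex y.1 s.
Proof.
case: y => -[v p] t nb; rewrite /pivot -val_eqE /= => st.
have [t0|t0] := eqVneq t ord0.
  have {}st : s != 0 :> nat by rewrite t0 in st.
  have hs : s.-1 < m.+2 by have := ltn_ord s; lia.
  exists (Ordinal hs); first by rewrite -val_eqE /=; have := ltn_ord s; lia.
  apply/ffunP => j; rewrite !vertexE /= ffunE permM pred_permE.
  have [h _] := boundaryPn j nb; move: h => /= h.
  have [pj|pj] := eqVneq (p j) ord0.
    have := h (introT eqP t0) (introT eqP pj).
    by move=> vj; rewrite pj !inordK /=; have := ltn_ord s; lia.
  rewrite -val_eqE /= in pj; rewrite !inordK; have := ltn_ord (p j);
    have := ltn_ord (v j); lia.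
have [tm|tm] := eqVneq t ord_max.
  have {}st : s != m.+1 :> nat by rewrite tm in st.
  have hs : s.+1 < m.+2 by have := ltn_ord s; lia.
  exists (Ordinal hs); first by rewrite -val_eqE /=; lia.
  apply/ffunP => j; rewrite !vertexE /= ffunE permM pred_permVE.
  have [_ h] := boundaryPn j nb; move: h => /= h.
  have [pj|pj] := eqVneq (p j) ord_max.
    have := h (introT eqP tm) (introT eqP pj).
    by have := ltn_ord (v j); move=> ? vj; rewrite pj !inordK /=; have := ltn_ord s; lia.
  rewrite -val_eqE /= in pj; rewrite !inordK; have := ltn_ord (p j);
    have := ltn_ord (v j); lia.
exists s; first by rewrite -val_eqE.
move: t0 tm; rewrite -!val_eqE /= => t0 tm.
apply/ffunP => j; rewrite !vertexE /= permM; congr (_ + nat_of_bool _).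
have := ltn_ord t => ht.
(* Swapping steps [t.-1] and [t] affects vertex [t] only. *)
case: tpermP => [e|e|//]; rewrite e !inordK; lia.
Qed.

Lemma pivot_boundary y : ~~ boundary y -> ~~ boundary (pivot y).
Proof.
move=> nb; apply/existsPn => j; move: nb; case: y => -[v p] t nb; rewrite /pivot.
have [t0|t0] := eqVneq t ord0.
  rewrite /= -val_eqE /= ffunE permM pred_permE.
  have [h _] := boundaryPn j nb; move: h => /= h.
  have [pj|pj] := eqVneq (p j) ord0.
    have := h (introT eqP t0) (introT eqP pj).
    by move=> vj; rewrite -!val_eqE /= inordK; lia.
  rewrite -val_eqE /= in pj; rewrite -!val_eqE /= !inordK; have := ltn_ord (p j);
    have := ltn_ord (v j); lia.
have [tm|tm] := eqVneq t ord_max.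
  rewrite /= -val_eqE /= ffunE permM pred_permVE.
  have [_ h] := boundaryPn j nb; move: h => /= h.
  have [pj|pj] := eqVneq (p j) ord_max.
    have := h (introT eqP tm) (introT eqP pj).
    by have := ltn_ord (v j); move=> ? vj; rewrite -!val_eqE /= inordK; lia.
  rewrite -val_eqE /= in pj; rewrite -!val_eqE /= !inordK; have := ltn_ord (p j);
    have := ltn_ord (v j); lia.
by rewrite /= (negPf t0) (negPf tm).
Qed.

Lemma pivot_door y : ~~ boundary y -> door y -> door (pivot y).
Proof.
move=> nb /doorP dy; apply/doorP => l /dy[s st <-].
by have [s' st' e] := pivot_vertex nb st; exists s'; rewrite ?e.
Qed.

(** * The unique door on the boundary *)

Definition corner : cell * 'I_m.+2 :=
  (([ffun => ord_max], perm (@rev_ord_inj m.+1)), ord0).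

Lemma even_nonboundary : ~~ odd #|[set y | door y && ~~ boundary y]|.
Proof.
apply: (@even_card_involution _ _ pivot) => y; rewrite ?inE => /andP[dy nb].
- by rewrite pivot_door // pivot_boundary.
- exact: pivotK.
- exact: pivot_neq.
Qed.

Lemma corner_vertex (s : nat) (j : 'I_m.+1) : vertex corner.1 s j = M + (m < s + j).
Proof.
rewrite vertexE /= ffunE permE /=; congr (_ + nat_of_bool _).
by have := ltn_ord j; lia.
Qed.

Lemma corner_boundary : boundary corner.
Proof.
apply/existsP; exists ord_max; rewrite /= ffunE permE !eqxx /= -val_eqE /=.
by rewrite subnn.
Qed.

Lemma corner_door : 0 < M -> door corner.
Proof.
move=> M0; apply/doorP => l hl.
(* At vertex [m.+1 - l] the movable cuts numbered above [l] are at [M.+1], the others at [M]. Only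
   pieces 0 and [l] are nonempty, and [lab_out] selects [l]. *)
have hs : m.+1 - l < m.+2 by lia.
exists (Ordinal hs); first by rewrite -val_eqE /=; lia.
set c := vertex _ _.
have cE (j : 'I_m.+1) : c j = M + (l <= j).
  by rewrite /c corner_vertex /=; congr (_ + nat_of_bool _); lia.
have cutE (j : nat) : 0 < j <= m.+1 -> cut c j = M + (l < j).
  by case: j => // j /andP[_ hj]; have := cutS c (Ordinal hj); rewrite cE => /= ->; rewrite ltnS.
have out : c ord_max = M.+1 by rewrite cE /=; lia.
have h1 := lab_lt c; have h2 := lab_out out.
apply: val_inj => /=; apply/eqP; rewrite eqn_leq; apply/andP; split.
  rewrite leqNgt; apply/negP => hc; move: h1; have := ltn_ord (lab c) => h.
  case: (ltnP (lab c) m.+1) => h3; first by rewrite !cutE; lia.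
  have e : lab c = m.+1 :> nat by lia.
  by rewrite e cut_last cutE; lia.
rewrite leqNgt; apply/negP => hc; have := h2 _ hc (ltnW hl).
case: (posnP l) => [l0|l0]; first by rewrite l0 in hc.
rewrite !cutE; lia.
Qed.

Lemma boundary_door y : door y -> boundary y -> y = corner.
Proof.
move=> dy /existsP[j]; case/orP => /andP[/andP[/eqP yt /eqP pj] /eqP vj]; last first.
  (* Lower face: coordinate [j] is 0 on the whole facet, so piece [j] ends at 0 and label [j] cannot
     occur. *)
  have hj : j < m.+2 by have := ltn_ord j; lia.
  move/doorP: (dy) => /(_ (Ordinal hj) (ltn_ord j))[s st ls].
  have := lab_lt (vertex y.1 s); rewrite ls /= cutS vertexE pj vj /=.
  by move: st; rewrite yt -val_eqE /=; have := ltn_ord s; lia.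
have wj (s : nat) : 0 < s -> vertex y.1 s j = M.+1.
  by move=> s0; rewrite vertexE pj vj /=; lia.
have wle (s : nat) (i i' : 'I_m.+1) : i <= i' -> vertex y.1 s i <= vertex y.1 s i'.
  by move=> ii; rewrite -!cutS; apply: door_mono => //; rewrite ltnS.
have wmax (s : nat) : 0 < s -> vertex y.1 s ord_max = M.+1.
  move=> s0; apply/eqP; rewrite eqn_leq vertex_ub -(wj _ s0) wle //.
  by rewrite -ltnS.
(* At the vertex labelled 0, all later pieces have nonpositive length, so no cut lies left of the
   last one, which is at [M.+1]. *)
have top (i : 'I_m.+1) : y.1.1 i = M :> nat.
  move/doorP: (dy) => /(_ ord0 isT)[s st ls].
  have s0 : 0 < s by move: st; rewrite yt -val_eqE /= lt0n.
  have h := lab_out (wmax _ s0).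
  have c1 (l : nat) : l < m.+1 -> vertex y.1 s ord_max <= vertex y.1 s (inord (m - l)).
    elim: l => [|l IH] hl.
      by rewrite subn0; apply: wle; rewrite inordK.
    apply: leq_trans (IH (ltnW hl)) _.
    have := h (m - l); rewrite ls /= => /(_ ltac:(lia) ltac:(lia)).
    rewrite -[in cut _ _.+1](@inordK m (m - l)); last by lia.
    rewrite cutS; have -> : m - l = (inord (m - l.+1) : 'I_m.+1).+1.
      by rewrite inordK; lia.
    by rewrite cutS.
  have := c1 (m - i); rewrite subKn; last by rewrite -ltnS.
  rewrite inord_val wmax // vertexE => /(_ ltac:(lia)).
  by have := ltn_ord (y.1.1 i); lia.
(* With equal bases, sortedness at every vertex forces higher coordinates to step first: the
   permutation is the reversal. *)
have pdec (i i' : 'I_m.+1) : i < i' -> y.1.2 i' < y.1.2 i.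
  move=> ii; rewrite ltn_neqAle; apply/andP; split.
    by apply/eqP => /val_inj /perm_inj e; move: ii; rewrite e ltnn.
  have := wle (y.1.2 i).+1 i i' (ltnW ii); rewrite !vertexE !top; lia.
have pub (i : 'I_m.+1) : forall n, i = n :> nat -> y.1.2 i <= m - n.
  move=> n; elim: n i => [|n IH] i e; first by rewrite subn0 -ltnS.
  have hn : n < m.+1 by have := ltn_ord i; lia.
  have := IH (Ordinal hn) erefl; have := pdec (Ordinal hn) i; rewrite e /=.
  by move=> /(_ ltac:(lia)); lia.
have plb (n : nat) : forall i : 'I_m.+1, i = m - n :> nat -> n <= m -> n <= y.1.2 i.
  elim: n => // n IH i e hn.
  have hi : i.+1 < m.+1 by lia.
  have := IH (Ordinal hi); have := pdec i (Ordinal hi); rewrite /=.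
  by move=> /(_ ltac:(lia)) h1 h2; have := h2 ltac:(lia) ltac:(lia); lia.
case: y => -[v p] t in yt top pub plb pdec wmax wle wj dy pj vj *.
rewrite /corner; congr (_, _, _); last exact: yt.
  by apply/ffunP => i; rewrite ffunE; apply: val_inj; exact: top.
apply/permP => i; rewrite permE; apply: val_inj => /=; rewrite subSS.
apply/eqP; rewrite eqn_leq (pub i i erefl) /= plb //; last by lia.
by rewrite subKn // -ltnS.
Qed.

(** Without a full cell, [rotate] would pair up all doors, while [pivot] pairs up all but
    [corner]. *)
Lemma sperner : 0 < M -> exists x, full x.
Proof.
move=> M0; case: (boolP [exists x, full x]) => [/existsP //|/existsPn nf].
case/negP: (even_doors nf).
have cd : corner \in [set y | door y] by rewrite inE corner_door.
rewrite (cardsD1 corner) cd /=.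
have -> : [set y | door y] :\ corner = [set y | door y && ~~ boundary y].
  apply/setP => y; rewrite !inE; have [->|ny] /= := eqVneq y corner.
    by rewrite corner_boundary andbF.
  case dy: (door y) => //=; apply/esym/negP => b.
  by rewrite (boundary_door dy b) eqxx in ny.
exact: even_nonboundary.
Qed.
End Sperner.

(** * Fairness of balanced allocations *)

Section Fairness.
Variables (G : finType) (k : nat) (v : G -> bool) (alloc : {ffun G -> 'I_k}).
Implicit Type S : {set G}.

Lemma util_card S : util v S = #|S :&: [set g | v g]|.
Proof.
rewrite /util -sum1_card big_mkcond [RHS]big_mkcond /=; apply: eq_bigr => g _.
by rewrite !inE; case: (g \in S) => //=; case: (v g).
Qed.

Lemma sum_util_bundle (P : {ffun G -> 'I_k}) : \sum_j util v (bundle P j) = util v setT.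
Proof.
rewrite /util [RHS](partition_big P predT) //=; apply: eq_bigr => j _.
by apply: eq_bigl => g; rewrite !inE.
Qed.

Lemma util_setC S : util v (~: S) = util v setT - util v S.
Proof.
rewrite !util_card setTI -(cardsID S [set g | v g]) setIC [_ :&: S]setIC addKn.
by rewrite setDE setIC.
Qed.

Variable i : 'I_k.
Hypothesis balanced : forall j, util v (bundle alloc j) <= (util v (bundle alloc i)).+1.

Lemma total_le : util v setT <= k * util v (bundle alloc i) + k.-1.
Proof.
rewrite -(sum_util_bundle alloc) (bigD1 i) //=.
have : \sum_(j | j != i) util v (bundle alloc j) <=
       \sum_(j < k | j != i) (util v (bundle alloc i)).+1 by apply: leq_sum.
rewrite sum_nat_const cardC1 card_ord; move: (\sum_(j | _) _) (util _ _) => A B.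
have [q ->] : exists q, k = q.+1 by exists k.-1; have := ltn_ord i; lia.
by rewrite /= mulnS mulSn; lia.
Qed.

Lemma balanced_EF1 : EF1 v alloc i.
Proof.
apply/forallP => j; apply/existsP.
have := balanced j; rewrite leq_eqVlt => /orP[/eqP e|le]; last first.
  by exists set0; rewrite sub0set cards0 setD0.
have [g gj] : exists g, g \in bundle alloc j :&: [set g | v g].
  by apply/set0Pn; rewrite -cards_eq0 -util_card e.
exists [set g]; move: (gj); rewrite sub1set cards1 inE => /andP[-> vg] /=.
rewrite -ltnS -e !util_card (cardsD1 g (bundle _ _ :&: _)) gj add1n ltnS.
by apply: subset_leq_card; apply/subsetP => g'; rewrite !inE => /andP[/andP[-> ->] ->].
Qed.

(** Either [k.-1] liked goods are removed, which suffices by [total_le], or all liked goods outside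
    the bundle are. *)
Lemma balanced_PROPk1 : PROPk1 v alloc i.
Proof.
set D := ~: bundle alloc i :&: [set g | v g].
have [C sC cC] : exists2 C : {set G}, C \subset D & #|C| = minn k.-1 #|D|.
  exists [set g in take k.-1 (enum D)].
    by apply/subsetP => g; rewrite inE => /mem_take; rewrite mem_enum.
  by rewrite cardsE (card_uniqP _) ?take_uniq ?enum_uniq // size_take_min -cardE.
have uC : util v C = #|C|.
  rewrite util_card; congr #|pred_of_set _|; apply/setIidPl.
  exact: subset_trans sC (subsetIr _ _).
have uD : #|D| = util v setT - util v (bundle alloc i) by rewrite -util_setC util_card.
apply/existsP; exists C; rewrite (subset_trans sC) ?subsetIl //= cC geq_minl /=.
rewrite util_setC uC cC uD; have := total_le; have := ltn_ord i.
rewrite minnE; move: (util _ _) (util _ _) => A B; nia.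
Qed.

Lemma bigminn_le (I : finType) (x : nat) (f : I -> nat) (j : I) :
  \big[minn/x]_i f i <= f j.
Proof.
rewrite unlock; elim: (index_enum I) (mem_index_enum j) => //= a s IH.
by rewrite inE => /orP[/eqP ->|/IH h]; rewrite geq_min ?leqnn ?h ?orbT.
Qed.

(** If every part of [P] beat the bundle, the total would exceed the bound of [total_le]. *)
Lemma balanced_MMS_fair : MMS_fair v alloc i.
Proof.
rewrite /MMS_fair /MMS; apply/bigmax_leqP => P _.
have [j le] : exists j, util v (bundle P j) <= util v (bundle alloc i).
  apply/existsP; rewrite -[X in is_true X]negbK negb_exists; apply/negP => /forallP h.
  have := total_le; rewrite -(sum_util_bundle P).
  have : \sum_(j < k) (util v (bundle alloc i)).+1 <= \sum_j util v (bundle P j).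
    by apply: leq_sum => j _; rewrite ltnNge h.
  by rewrite sum_nat_const card_ord; have := ltn_ord i; nia.
exact: leq_trans (bigminn_le _ _ j) le.
Qed.

End Fairness.

(** * Rounding cuts to whole goods *)

Section Rounding.
Variables (m : nat) (w : nat -> bool).
Local Notation k := m.+2.

(* Good i is replaced by the k unit copies i * k, ..., i * k + k - 1 on the line. *)
Definition units_before (p : nat) : nat := \sum_(0 <= q < p) w (q %/ k).
Definition goods_before (q : nat) : nat := \sum_(0 <= i < q) w i.

(* The number of whole goods left of p, a cut good counting iff more than s of its k units are. *)
Definition round_cut (s p : nat) : nat := (p + (m.+1 - s)) %/ k.

Lemma units_beforeE q f : f <= k ->
  units_before (q * k + f) = k * goods_before q + f * w q.
Proof.
rewrite /units_before /goods_before; elim: q f => [|q IH] f hf.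
  rewrite big_nil mul0n muln0 !add0n.
  elim: f hf => [|f IHf] hf; first by rewrite big_nil.
  by rewrite big_nat_recr //= IHf 1?ltnW // divn_small //; lia.
elim: f hf => [|f IHf] hf.
  by rewrite addn0 mulSn addnC IH // big_nat_recr //=; lia.
rewrite addnS big_nat_recr //= IHf 1?ltnW // divnMDl // divn_small // addn0; lia.
Qed.

Lemma round_cut_eq s q f : s <= m.+1 -> f < k -> round_cut s (q * k + f) = q + (s < f).
Proof.
move=> hs hf; rewrite /round_cut -addnA divnMDl //; congr (_ + _).
case: ltnP => h; last by rewrite divn_small; lia.
have -> : f + (m.+1 - s) = 1 * k + (f - s.+1) by lia.
by rewrite divnMDl // divn_small; lia.
Qed.

(** Counting a cut good adds at most k - 1 - s units, dropping it loses at most s; the errors at the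
    two ends of a piece total at most k - 1. *)
Lemma round_cut_dev s p : s <= m.+1 ->
  k * goods_before (round_cut s p) <= units_before p + (m.+1 - s) /\
  units_before p <= k * goods_before (round_cut s p) + s.
Proof.
move=> hs; rewrite (divn_eq p k); set q := p %/ k; set f := p %% k.
have hf : f < k by rewrite ltn_mod.
rewrite round_cut_eq // (units_beforeE _ (ltnW hf)).
case: ltnP => h; rewrite ?addn0 ?addn1; last by case: (w q); lia.
have -> : goods_before q.+1 = goods_before q + w q by rewrite /goods_before big_nat_recr.
by case: (w q); lia.
Qed.

Lemma round_cut_mono s p p' : p <= p' -> round_cut s p <= round_cut s p'.
Proof. by move=> h; rewrite leq_div2r // leq_add2r. Qed.

(** The rounding changes only when the part of the cut good on the left grows from s to s + 1
    units. *)
Lemma round_cut_free s p : s <= m.+1 -> p %% k != s -> round_cut s p.+1 = round_cut s p.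
Proof.
move=> hs hp; rewrite (divn_eq p k) -addnS; have hf : p %% k < k by rewrite ltn_mod.
have [e|ne] := eqVneq (p %% k) m.+1.
  have -> : p %/ k * k + (p %% k).+1 = (p %/ k).+1 * k + 0 by rewrite e; lia.
  by rewrite !round_cut_eq //; lia.
by rewrite !round_cut_eq //; lia.
Qed.

Lemma goods_before_mono q q' : q <= q' -> goods_before q <= goods_before q'.
Proof. by move=> h; rewrite /goods_before [leqRHS](big_cat_nat (n := q)) //= leq_addr. Qed.

Lemma units_before_mono q q' : q <= q' -> units_before q <= units_before q'.
Proof. by move=> h; rewrite /units_before [leqRHS](big_cat_nat (n := q)) //= leq_addr. Qed.

Definition units_between a b := units_before b - units_before a.
Definition goods_between a b := goods_before b - goods_before a.

(* Rounding changes the length of a piece by at most k - 1 units, that is, by less than one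
   good; two such errors cannot create an envy of two whole goods. *)
Lemma round_envy s a b a' b' : s <= m.+1 -> a <= b -> a' <= b' ->
  units_between a' b' <= units_between a b ->
  goods_between (round_cut s a') (round_cut s b') <=
  (goods_between (round_cut s a) (round_cut s b)).+1.
Proof.
rewrite /units_between /goods_between => hs ab ab'.
have := goods_before_mono (round_cut_mono s ab).
have := goods_before_mono (round_cut_mono s ab').
have := units_before_mono ab; have := units_before_mono ab'.
have [] := round_cut_dev a hs; have [] := round_cut_dev b hs.
have [] := round_cut_dev a' hs; have [] := round_cut_dev b' hs.
move: (goods_before _) (goods_before _) (goods_before _) (goods_before _).
move: (units_before _) (units_before _) (units_before _) (units_before _).
move=> *; nia.
Qed.

End Rounding.

(** * Owners, votes and labels *)

Section Labelling.
Variables (m N : nat) (n : 'I_m.+2 -> nat) (w : forall i, 'I_(n i) -> nat -> bool).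
Hypothesis n_gt0 : forall i, 0 < n i.
Local Notation k := m.+2.
(** One padding good beyond the [N] goods keeps [M] positive. *)
Local Notation M := (k * N.+1).
Local Notation vec := {ffun 'I_m.+1 -> nat}.
Local Notation cut := (cut M).

Definition nonempty (c : vec) (l : 'I_k) := cut c l < cut c l.+1.

Lemma ex_nonempty c : exists l, nonempty c l.
Proof.
apply/existsP; rewrite -[X in is_true X]negbK negb_exists; apply/negP => /forallP h.
have : forall l, l <= k -> cut c l = 0.
  elim=> // l IH hl; have := h (Ordinal hl); rewrite /nonempty /= IH ?(ltnW hl) //.
  by lia.
by move=> /(_ k (leqnn _)); rewrite cut_last.
Qed.

Definition some_nonempty c := xchoose (ex_nonempty c).

Lemma some_nonemptyP c : nonempty c (some_nonempty c).
Proof. exact: xchooseP. Qed.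

Definition piece_value (v : nat -> bool) (c : vec) (l : nat) :=
  units_between m v (cut c l) (cut c l.+1).

Definition favourite v (c : vec) : 'I_k :=
  [arg max_(l > some_nonempty c | nonempty c l) piece_value v c l].

(** Choosing among nonempty pieces costs nothing: truncated subtraction makes the others worth 0. *)
Lemma favouriteP v c : nonempty c (favourite v c) /\
  forall l : 'I_k, piece_value v c l <= piece_value v c (favourite v c).
Proof.
rewrite /favourite; case: arg_maxnP => [|l nl max]; first exact: some_nonemptyP.
split=> // l'; case: (boolP (nonempty c l')) => [/max //|].
rewrite /nonempty -leqNgt /piece_value /units_between => le.
by have := units_before_mono m v le; rewrite -subn_eq0 => /eqP ->.
Qed.

Definition voters (i : 'I_k) (c : vec) (l : 'I_k) : {set 'I_(n i)} :=
  [set a | favourite (w a) c == l].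

Definition elected (i : 'I_k) (c : vec) : 'I_k := [arg max_(l > ord0) #|voters i c l|].

Lemma elected_voters i c : n i <= k * #|voters i c (elected i c)|.
Proof.
rewrite /elected; case: arg_maxnP => // l _ max.
have e : \sum_l' #|voters i c l'| = n i.
  rewrite -[RHS]card_ord -sum1_card.
  rewrite [RHS](partition_big (fun a => favourite (w a) c) predT) //=.
  by apply: eq_bigr => l' _; rewrite -sum1_card; apply: eq_bigl => a; rewrite inE.
rewrite -{1}e -[k in k * _]card_ord -sum_nat_const; apply: leq_sum => l' _; exact: max.
Qed.

Lemma elected_nonempty i c : nonempty c (elected i c).
Proof.
have := elected_voters i c; have := n_gt0 i.
have [->|[a]] := set_0Vmem (voters i c (elected i c)).
  by rewrite cards0 muln0; case: (n i).
by rewrite inE => /eqP <- _ _; have [] := favouriteP (w a) c.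
Qed.

Definition last_nonempty (c : vec) : 'I_k :=
  [arg max_(l > some_nonempty c | nonempty c l) (l : nat)].

(* The coordinate sum grows by 1 along a cell, so its k vertices have k distinct owners. *)
Definition owner (c : vec) : 'I_k := inord ((\sum_j c j) %% k).

Definition valid (c : vec) := [forall l : 'I_k, cut c l <= cut c l.+1].

(* Outside the simplex of sorted cuts the label is artificial; since every label names a
   nonempty piece, a fully labelled cell lies inside the simplex anyway. *)
Definition label (c : vec) : 'I_k :=
  if valid c then elected (owner c) c else last_nonempty c.

Lemma label_nonempty c : nonempty c (label c).
Proof.
rewrite /label; case: ifP => _; first exact: elected_nonempty.
by rewrite /last_nonempty; case: arg_maxnP => //; exact: some_nonemptyP.
Qed.

Lemma label_out (c : vec) : c ord_max = M.+1 ->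
  forall l : nat, label c < l -> l <= m.+1 -> cut c l.+1 <= cut c l.
Proof.
move=> cM l; have -> : label c = last_nonempty c.
  rewrite /label ifN //; apply/negP => /forallP /(_ ord_max) /=.
  by have := cutS M c ord_max; rewrite cM /= cut_last => ->; rewrite ltnn.
rewrite /last_nonempty; case: arg_maxnP => [|l0 _ max lt hl]; first exact: some_nonemptyP.
rewrite leqNgt; apply/negP => h.
have hl' : l < k by [].
by have := max (Ordinal hl') h; rewrite /= leqNgt lt.
Qed.

Lemma owner_inj (x : cell m M) : {in gtn k &, forall s t : nat,
  owner (vertex x s) = owner (vertex x t) -> s = t}.
Proof.
have sumE t : t < k -> \sum_j vertex x t j = \sum_j (x.1 j : nat) + t.
  move=> ht; under eq_bigr do rewrite vertexE.
  rewrite big_split /=; congr (_ + _).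
  rewrite (reindex_inj (@perm_inj _ (x.2^-1)%g)) /=.
  under eq_bigr do rewrite permKV.
  rewrite -(big_mkord predT (fun j => (j < t) : nat)) (big_cat_nat (n := t)) //=.
  rewrite (eq_big_nat _ _ (F2 := fun=> 1)) => [|j /andP[_ ->] //].
  rewrite [X in _ + X](eq_big_nat _ _ (F2 := fun=> 0)) => [|j /andP[hj _]]; last by lia.
  by rewrite !sum_nat_const_nat; lia.
move=> s t /= hs ht /(congr1 val) /=; rewrite /owner !inordK ?ltn_mod // !sumE //.
by move/eqP; rewrite eqn_modDl !modn_small // => /eqP.
Qed.

(* Each of the m+1 base cuts lies in a single residue class mod k, so some class is missed;
   rounding with its threshold inside that class is constant on the cell. *)
Lemma free_residue (x : cell m M) : exists2 s, s <= m.+1 & forall j, x.1 j %% k != s.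
Proof.
pose f (j : 'I_m.+1) : 'I_k := inord (x.1 j %% k).
have [s hs] : exists s, s \notin codom f.
  apply/existsP; rewrite -[X in is_true X]negbK negb_exists; apply/negP => /forallP h.
  have : #|'I_k| <= #|codom f|.
    by apply/subset_leq_card/subsetP => s _; have := h s; rewrite negbK.
  have : #|codom f| <= #|'I_m.+1| by exact: leq_image_card.
  by rewrite !card_ord => h1 h2; have := leq_trans h2 h1; rewrite ltnn.
exists s; first by rewrite -ltnS.
move=> j; apply: contra hs => /eqP e; apply/codomP; exists j; apply: val_inj => /=.
by rewrite inordK ?ltn_mod // e.
Qed.

Lemma fair_line : exists (R : nat -> nat) (h : {perm 'I_k}),
  [/\ R 0 = 0, R k = N.+1, forall l, l < k -> R l <= R l.+1 &
   forall i : 'I_k, exists2 A : {set 'I_(n i)}, n i <= k * #|A| &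
     forall a, a \in A -> forall l : 'I_k,
       goods_between (w a) (R l) (R l.+1) <=
       (goods_between (w a) (R (h i)) (R (h i).+1)).+1].
Proof.
have [x /forallP fx] := sperner label_nonempty label_out (isT : 0 < M).
have [s hs free] := free_residue x.
have fx' l : exists t : 'I_k, label (vertex x t) == l by apply/existsP.
pose T l := xchoose (fx' l); have TP l : label (vertex x (T l)) = l.
  exact/eqP/(xchooseP (fx' l)).
(* Each piece is nonempty at the vertex carrying its label, so the cuts are sorted at every
   vertex. *)
have val t : valid (vertex x t).
  apply/forallP => l; apply: (@cut_vertex_le _ _ _ (T l) t).
  by have := label_nonempty (vertex x (T l)); rewrite TP.
have own_inj : injective (fun l => owner (vertex x (T l))).
  by move=> l l' /owner_inj e; rewrite -(TP l) -(TP l') e ?inE.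
(* Group [i] owns the chosen vertex labelled [h i] and receives that piece. *)
pose h := (perm own_inj)^-1%g.
have RE t l : round_cut m s (cut (vertex x t) l) = round_cut m s (cut (vertex x 0) l).
  case: l => // l; case: (ltnP l m.+1) => hl; last first.
    by rewrite /cut /= ltnNge hl.
  rewrite -[l]/(nat_of_ord (Ordinal hl)) !cutS !vertexE ltn0 addn0.
  by case: (_ < t); rewrite ?addn0 // addn1 round_cut_free.
pose R l := round_cut m s (cut (vertex x 0) l).
exists R, h; split.
- by rewrite /R cut0 /round_cut divn_small; lia.
- by rewrite /R cut_last mulnC -[_ * _]addn0 round_cut_eq //; lia.
- move=> l hl; apply: round_cut_mono.
  by move/forallP: (val 0) => /(_ (Ordinal hl)).
move=> i; pose t := T (h i); pose c := vertex x t.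
have ci : owner c = i by have := permKV (perm own_inj) i; rewrite permE.
exists (voters i c (h i)).
  have := elected_voters i c; have := TP (h i); rewrite -/t -/c /label val ci.
  by move=> ->.
move=> a; rewrite inE => /eqP fa l; rewrite /R -!(RE t).
move/forallP: (val t) => vt; apply: round_envy => //.
by have [_] := favouriteP (w a) c; rewrite fa; apply.
Qed.

End Labelling.

(** * From pieces of the line to bundles of goods *)

Theorem mainTheorem17 (G : finType) (k : nat) (hk : 2 <= k)
  (n : 'I_k -> nat) (hn : forall i, 0 < n i)
  (u : forall i : 'I_k, 'I_(n i) -> G -> bool) :
  exists alloc : {ffun G -> 'I_k},
    forall i : 'I_k,
      n i <= k * #|[set a : 'I_(n i) |
                     [&& EF1 (u i a) alloc i, PROPk1 (u i a) alloc i
                       & MMS_fair (u i a) alloc i]]|.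
Proof.
case: k hk n hn u => [//|[//|m]] _ n hn u.
(* The default [false] makes the padding good at position [#|G|] worthless. *)
pose w i (a : 'I_(n i)) q := nth false [seq u i a g | g <- enum G] q.
have [R [h [R0 Rk Rmono fair]]] := fair_line #|G| w hn.
have Rle l l' : l <= l' -> l' <= m.+2 -> R l <= R l'.
  elim: l' => [|l' IH]; first by rewrite leqn0 => /eqP ->.
  rewrite leq_eqVlt => /orP[/eqP -> //|ll hl].
  exact: leq_trans (IH ll (ltnW hl)) (Rmono _ hl).
pose in_piece q (l : 'I_m.+2) := R l <= q < R l.+1.
pose piece q := odflt ord0 [pick l | in_piece q l].
have piece_uniq q (l l' : 'I_m.+2) : in_piece q l -> in_piece q l' -> l = l'.
  move=> /andP[a b] /andP[a' b']; apply: val_inj => /=; apply/eqP.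
  rewrite eqn_leq; apply/andP; split; rewrite leqNgt; apply/negP => lt.
    by have := leq_trans b' (leq_trans (Rle _ _ lt (ltnW (ltn_ord l))) a); rewrite ltnn.
  by have := leq_trans b (leq_trans (Rle _ _ lt (ltnW (ltn_ord l'))) a'); rewrite ltnn.
have pieceP q l : q < #|G| -> (piece q == l) = in_piece q l.
  move=> hq; rewrite /piece; case: pickP => [l' hl'|no] /=.
    by apply/eqP/idP => [<- //|]; exact: piece_uniq.
  have : forall l, l <= m.+2 -> R l <= q.
    elim=> [|j IH] hj; first by rewrite R0.
    by have := no (Ordinal hj); rewrite /in_piece (IH (ltnW hj)) /=; lia.
  by move=> /(_ m.+2 (leqnn _)); rewrite Rk; lia.
exists [ffun g => (h^-1)%g (piece (enum_rank g))] => i.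
set alloc := [ffun _ => _].
have utilE (a : 'I_(n i)) j :
    util (u i a) (bundle alloc j) = goods_between (w i a) (R (h j)) (R (h j).+1).
  have RS : R (h j).+1 <= #|G|.+1 by rewrite -Rk Rle.
  rewrite /goods_between /goods_before (big_cat_nat (n := R (h j)) (p := R (h j).+1)) //=;
    last exact: Rmono.
  rewrite addKn.
  transitivity (\sum_(0 <= q < #|G|.+1 | in_piece q (h j)) (w i a q : nat)); last first.
    rewrite (big_cat_nat (n := R (h j).+1)) //=.
    rewrite [X in _ + X]big_nat_cond [X in _ + X]big_pred0; last first.
      by move=> q; rewrite /in_piece; lia.
    rewrite addn0 (big_cat_nat (n := R (h j))) //=; last exact: Rmono.
    rewrite [X in X + _]big_nat_cond [X in X + _]big_pred0; last by move=> q; rewrite /in_piece; lia.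
    rewrite add0n big_nat_cond [RHS]big_nat_cond; apply: eq_bigl => q.
    by rewrite /in_piece; lia.
  rewrite big_mkcond big_nat_recr //= -big_mkcond /=.
  rewrite [X in _ = _ + X](_ : _ = 0) ?addn0; last first.
    by case: ifP => // _; rewrite /w nth_default // size_map -cardE.
  rewrite big_mkord (reindex (@enum_rank G)) /=; last exact: onW_bij (enum_rank_bij G).
  rewrite /util [LHS]big_mkcond [RHS]big_mkcond /=; apply: eq_bigr => g _.
  rewrite inE ffunE -pieceP // (canF_eq (permK (h^-1)%g)) invgK.
  case: ifP => // _; congr nat_of_bool.
  rewrite /w (nth_map g) -?cardE //; by rewrite nth_enum_rank.
have [A hA bal] := fair i; apply: leq_trans hA _; rewrite leq_mul2l /=.
apply/subset_leq_card/subsetP => a aA; rewrite inE.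
have bal' j : util (u i a) (bundle alloc j) <= (util (u i a) (bundle alloc i)).+1.
  by rewrite !utilE; exact: bal.
by rewrite balanced_EF1 // balanced_PROPk1 // balanced_MMS_fair.
Qed.
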